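(* There is no stationary $1$-dependent $3$-coloring of $\mathbb{Z}$.
   Context: A $q$-coloring of $\mathbb{Z}$ is a random element $X=(X_i)_{i\in\mathbb{Z}}$ of $\{1,\dots,q\}^{\mathbb{Z}}$ such that almost surely $X_i\neq X_{i+1}$ for all $i$. A process $X=(X_i)_{i\in\mathbb{Z}}$ is $k$-dependent if $(X_i)_{i\in A}$ is independent of $(X_i)_{i\in B}$ for any subsets $A,B\subseteq\mathbb{Z}$ that satisfy $|u-v|>k$ for all $u\in A$ and $v\in B$. It is stationary if $(X_{i+u})_{i\in\mathbb{Z}}$ and $(X_i)_{i\in\mathbb{Z}}$ are equal in law for all $u\in\mathbb{Z}$. *)

(* Defs.v *)
From HB Require Import structures.
From mathcomp Require Import all_boot all_order all_algebra.
From mathcomp Require Import all_classical all_reals all_analysis.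
Set Implicit Arguments.
Unset Strict Implicit.
Unset Printing Implicit Defensive.
Import Order.TTheory GRing.Theory Num.Theory.
Local Open Scope classical_set_scope.
Local Open Scope ring_scope.

(* The sigma-algebra on {1, ..., q}^Z generated by the coordinates with index
   in A; the colors are labeled 0, ..., q - 1.  The preimages under X of its
   members are exactly the events of sigma (X_i, i in A). *)
Definition coord_salgebra (q : nat) (A : set int) : set (set (int -> 'I_q)) :=
  <<s [set E | exists2 i, A i & exists c : 'I_q, E = [set x | x i = c]] >>.

Definition random_sequence (d : measure_display) (T : measurableType d)
    (q : nat) (X : T -> int -> 'I_q) : Prop :=
  forall E, coord_salgebra setT E -> measurable (X @^-1` E).

Definition coloring (R : realType) (d : measure_display)
    (T : measurableType d) (P : probability T R)
    (q : nat) (X : T -> int -> 'I_q) : Prop :=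
  random_sequence X /\
  {ae P, forall w, forall i : int, X w i <> X w (i + 1)}.

Definition dependent (R : realType) (d : measure_display)
    (T : measurableType d) (P : probability T R)
    (k : nat) (q : nat) (X : T -> int -> 'I_q) : Prop :=
  forall A B : set int,
    (forall u v : int, A u -> B v -> k%:Z < `|u - v|) ->
    forall E F, coord_salgebra A E -> coord_salgebra B F ->
      P (X @^-1` E `&` X @^-1` F) = (P (X @^-1` E) * P (X @^-1` F))%E.

Definition equal_in_law (R : realType) (d : measure_display)
    (T : measurableType d) (P : probability T R)
    (q : nat) (X Y : T -> int -> 'I_q) : Prop :=
  forall E, coord_salgebra setT E -> P (X @^-1` E) = P (Y @^-1` E).

Definition stationary (R : realType) (d : measure_display)
    (T : measurableType d) (P : probability T R)
    (q : nat) (X : T -> int -> 'I_q) : Prop :=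
  forall u : int, equal_in_law P (fun w i => X w (i + u)) X.

(* Main.v *)
Require Import Defs.
From mathcomp Require Import all_boot all_order all_algebra.
From mathcomp Require Import all_classical all_reals all_analysis.
From mathcomp Require Import ring lra zify.

(** A color [a] cannot be frequent in a stationary 1-dependent coloring.  Let
    [p] be the probability of [a] at a site and [u n] the probability that [a]
    is absent from [n] consecutive sites.  For [a] to be absent from the first
    [n.+1] sites and present at the next one, it is enough that it be absent
    from the first [n] and present at the last: adjacent colors differ, so its
    presence at the last site already excludes it from the site before.  The
    two remaining conditions concern sites at distance 2, hence are
    independent, and
      [u n.+2 = u n.+1 - p * u n], with [u 0 = 1] and [u 1 = 1 - p].
    This is [avoid_prob_recurrence].  All the [u n] are probabilities, and
    [u 5 = (1 - 2 * p) * (1 - 3 * p) - p ^+ 3] with [u 2 = 1 - 2 * p], so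
    nonnegativity forces [p < 1 / 3] ([color_prob_lt_third]).  Three colors of
    probability less than [1 / 3] cannot cover the space. *)

Import Order.TTheory GRing.Theory Num.Theory.

Section ColorEvents.
Local Open Scope classical_set_scope.
Local Open Scope ring_scope.
Context {q : nat} (a : 'I_q).

Definition color_at (i : int) : set (int -> 'I_q) := [set x | x i = a].

Definition avoid (n : nat) : set (int -> 'I_q) :=
  [set x | forall j : nat, (j < n)%N -> x j%:Z <> a].

Lemma coord_salgebra_color_at (A : set int) (i : int) :
  A i -> coord_salgebra A (color_at i).
Proof. by move=> Ai; apply: sub_sigma_algebra; exists i => //; exists a. Qed.

(** A sigma-algebra is closed under complements and countable unions, so this
    form makes the event measurable with respect to the sites below [n]. *)
Lemma avoidE (n : nat) :
  avoid n =
  setT `\` \bigcup_j (if (j < n)%N then color_at j%:Z else set0).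
Proof.
apply/seteqP; split => [x xa|x [_ xa] j jn xja].
  by split=> // -[j _]; case: ifP => // jn; exact: xa.
by apply: xa; exists j => //; rewrite jn.
Qed.

Lemma coord_salgebra_avoid (A : set int) (n : nat) :
  (forall j : nat, (j < n)%N -> A j%:Z) -> coord_salgebra A (avoid n).
Proof.
move=> An; rewrite avoidE.
have [s0 sD sU] := smallest_sigma_algebra [set: int -> 'I_q]
  [set E | exists2 i, A i & exists c : 'I_q, E = [set x | x i = c]].
apply: sD; apply: sU => j; case: ifP => [jn|_]; last exact: s0.
exact: coord_salgebra_color_at (An j jn).
Qed.

Lemma avoid0 : avoid 0 = setT.
Proof. by apply/seteqP; split. Qed.

Lemma avoidS (n : nat) : avoid n.+1 = avoid n `\` color_at n%:Z.
Proof.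
apply/seteqP; split => [x xa|x [xa xn] j].
  by split=> [j jn|]; apply: xa => //; apply: ltnW.
by rewrite ltnS leq_eqVlt => /predU1P[->|/xa].
Qed.

End ColorEvents.

Section ColorProbability.
Local Open Scope classical_set_scope.
Local Open Scope ring_scope.
Context {R : realType} {d : measure_display} {T : measurableType d}.
Context {P : probability T R} {q : nat} {X : T -> int -> 'I_q} (a : 'I_q).
Hypotheses (colX : coloring P X) (statX : stationary P X)
  (depX : dependent P 1 X).

Let prob (E : set (int -> 'I_q)) : R := fine (P (X @^-1` E)).

Lemma measurable_color_at (i : int) : measurable (X @^-1` color_at a i).
Proof. by apply: (proj1 colX); apply: coord_salgebra_color_at. Qed.

Lemma measurable_avoid (n : nat) : measurable (X @^-1` avoid a n).
Proof. by apply: (proj1 colX); apply: coord_salgebra_avoid. Qed.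

Lemma color_prob_stationary (i : int) :
  P (X @^-1` color_at a i) = P (X @^-1` color_at a 0).
Proof.
have E0 : coord_salgebra setT (color_at a 0) by exact: coord_salgebra_color_at.
by rewrite -(statX i _ E0); congr (P _); apply/seteqP;
   split => w; rewrite /color_at /= add0r.
Qed.

(** The site [n] drops out of the event because, almost surely, it cannot
    carry the same color as the site [n.+1]. *)
Lemma avoidS_color_prob (n : nat) :
  P (X @^-1` avoid a n.+1 `&` X @^-1` color_at a n.+1%:Z) =
  P (X @^-1` avoid a n `&` X @^-1` color_at a n.+1%:Z).
Proof.
have mC := measurable_color_at; have mA := measurable_avoid.
have mB : measurable (X @^-1` avoid a n `&` X @^-1` color_at a n.+1%:Z).
  exact: measurableI.
rewrite (measureDI P mB (mC n%:Z)) (_ : _ `\` _ =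
  X @^-1` avoid a n.+1 `&` X @^-1` color_at a n.+1%:Z); last first.
  rewrite avoidS; apply/seteqP; split => [w [[? ?] ?]|w [[? ?] ?]] //=.
rewrite [X in (_ + X)%E](_ : _ = 0%E) ?adde0//.
apply: measure_negligible; first exact: measurableI.
apply: negligibleS (proj2 colX) => w [[_ wS] wn] /(_ n%:Z); apply.
by rewrite wn -wS; congr (X w _); lia.
Qed.

Lemma avoid_prob_recurrence (n : nat) :
  prob (avoid a n.+2) =
  prob (avoid a n.+1) - prob (color_at a 0) * prob (avoid a n).
Proof.
have mC := measurable_color_at; have mA := measurable_avoid.
have split_n : P (X @^-1` avoid a n.+1) = (P (X @^-1` avoid a n.+2) +
    P (X @^-1` avoid a n) * P (X @^-1` color_at a 0))%E.
  apply: etrans (measureDI P (mA n.+1) (mC n.+1%:Z)) _.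
  rewrite [avoid a n.+2]avoidS -(color_prob_stationary n.+1%:Z).
  congr (_ + _)%E; apply: etrans (avoidS_color_prob n) _.
  apply: (depX [set i | i < n%:Z] [set n.+1%:Z]).
  - by move=> u v /= un ->; lia.
  - by apply: coord_salgebra_avoid => j /= jn; lia.
  - exact: coord_salgebra_color_at.
rewrite /prob split_n fineD ?fineM ?fin_numM ?fin_num_measure//; ring.
Qed.

Lemma avoid_prob0 : prob (avoid a 0) = 1.
Proof. by rewrite /prob avoid0 preimage_setT probability_setT. Qed.

Lemma avoid_prob1 : prob (avoid a 1) = 1 - prob (color_at a 0).
Proof.
have mC := measurable_color_at 0.
rewrite /prob avoidS avoid0 setTD -preimage_setC probability_setC//.
by rewrite fineB// fin_num_measure.
Qed.

(** Five sites suffice: if [p] were at least [1 / 3], the bound [p <= 1 / 2]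
    coming from two sites would make [(1 - 2 * p) * (1 - 3 * p)] nonpositive,
    and the probability of avoiding the color on five sites negative. *)
Lemma color_prob_lt_third : prob (color_at a 0) < 1 / 3.
Proof.
have pge0 : 0 <= prob (color_at a 0) by exact: fine_ge0.
have u2 : 0 <= prob (avoid a 2) by exact: fine_ge0.
have u5 : 0 <= prob (avoid a 5) by exact: fine_ge0.
move: u2 u5; rewrite !avoid_prob_recurrence avoid_prob1 avoid_prob0.
set p := prob _ in pge0 *; move=> u2 u5.
have {}u2 : 0 <= 1 - 2 * p by lra.
have {}u5 : p ^+ 3 <= (1 - 2 * p) * (1 - 3 * p) by lra.
rewrite ltNge; apply/negP => p_ge.
have : 0 < p ^+ 3 by apply: exprn_gt0; lra.
have : (1 - 2 * p) * (1 - 3 * p) <= 0 by apply: mulr_ge0_le0 => //; lra.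
lra.
Qed.

End ColorProbability.

Theorem theorem4 (R : realType) (d : measure_display) (T : measurableType d)
    (P : probability T R) :
  ~ exists X : T -> int -> 'I_3,
      [/\ coloring P X, stationary P X & dependent P 1 X].
Proof.
move=> [X [colX statX depX]].
pose E (c : 'I_3) := (X @^-1` color_at c 0)%classic.
have mE c : measurable (E c) by exact: measurable_color_at colX _.
have lt3 c : (fine (P (E c)) < 1 / 3)%R by exact: color_prob_lt_third.
have cover : ([set: T] `<=` E ord0 `|` E (inord 1) `|` E ord_max)%classic.
  move=> w _; rewrite /E /color_at /=.
  case: (X w 0) => -[|[|[|//]]] i3; [left; left|left; right|right];
    by apply: val_inj; rewrite /= ?inordK.
have : (1 <= P (E ord0) + P (E (inord 1)) + P (E ord_max))%E.
  rewrite -(probability_setT P).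
  have mU := measurableU _ _ (mE ord0) (mE (inord 1)).
  apply: le_trans (le_measure P _ _ cover) _; rewrite ?inE//.
    exact: measurableU.
  apply: le_trans (measureU2 P mU (mE ord_max)) _.
  by rewrite leeD2r// measureU2.
have fE c : P (E c) = (fine (P (E c)))%:E by rewrite fineK// fin_num_measure.
rewrite (fE ord0) (fE (inord 1)) (fE ord_max) -!EFinD lee_fin.
have := lt3 ord0; have := lt3 (inord 1); have := lt3 ord_max; lra.
Qed.
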